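(* Let $k,d,T\ge1$ and $h\ge0$, let $\mathcal K_1,\dots,\mathcal K_k\subseteq\mathbb R^d$ be nonempty convex sets, and let $\mathcal K=\mathcal K_1\times\dots\times\mathcal K_k$. For each $i\in\{1,\dots,k\}$ let $\mathcal A_i$ be an algorithm for online convex optimization with memory (OCO-M) over $\mathcal K_i$ with memory length $h$, and suppose that $\mathcal A_i$ has (average) regret $\mathcal R_T(\mathcal A_i)$ over $\mathcal K_i$ on the linear loss functions $\langle g^i_t,\cdot\rangle$, $g^i_t=\nabla\ell^i_t(x^i_{t-h:t})$, provided to it by the Multiplayer OCO with Memory procedure described in the context. Then the average multi-agent regret of that procedure satisfies $$\mathcal R_T(\mathcal A_{1:k})\le\sum_{i=1}^k\mathcal R_T(\mathcal A_i).$$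
   Context: Multiplayer OCO with memory. There are $k$ players and $T$ rounds; write $z_{a:b}=(z_a,\dots,z_b)$. In round $t$, player $i$ commits to a decision $x^i_t\in\mathcal K_i$; the joint decision is $x_t=(x^1_t,\dots,x^k_t)\in\mathcal K$. Decisions with index $s\le0$ are fixed arbitrary points $x^i_s\in\mathcal K_i$. A convex differentiable loss $\ell_t:\mathcal K^{h+1}\to\mathbb R$ is then incurred at $x_{t-h:t}$, and player $i$ observes $\ell^i_t:\mathcal K_i^{h+1}\to\mathbb R$, $\ell^i_t(z)=\ell_t(z,x^{-i}_{t-h:t})$, i.e. $\ell_t$ evaluated with player $i$'s components over the window replaced by $z$ and all other players' components kept at $x^j_{t-h:t}$, $j\ne i$. Put $\bar\ell_t(x)=\ell_t(x,\dots,x)$ for $x\in\mathcal K$. OCO-M algorithm. An OCO-M algorithm $\mathcal A_i$ over $\mathcal K_i$ is a rule that at each round $t$ outputs a point of $\mathcal K_i$ as a function of the loss functions (on $\mathcal K_i^{h+1}$) fed to it in rounds $1,\dots,t-1$. Multiplayer OCO with Memory procedure. In each round $t=1,\dots,T$, for each player $i$: $\mathcal A_i$ predicts $x^i_t$; compute $g^i_t=\nabla\ell^i_t(x^i_{t-h:t})\in(\mathbb R^d)^{h+1}$; feed $\mathcal A_i$ the linear loss function $\langle g^i_t,\cdot\rangle$ on $\mathcal K_i^{h+1}$. Regret. Let $\mathfrak L$ be the (nonempty, otherwise arbitrary) class of admissible loss sequences $(\ell_1,\dots,\ell_T)$ of convex differentiable functions on $\mathcal K^{h+1}$. Running the procedure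 on such a sequence determines the $x^i_t$ and $g^i_t$. The average multi-agent regret is $$\mathcal R_T(\mathcal A_{1:k})=\sup_{(\ell_1,\dots,\ell_T)\in\mathfrak L}\Big\{\frac1T\Big(\sum_{t=1}^T\ell_t(x_{t-h:t})-\inf_{x^*\in\mathcal K}\sum_{t=1}^T\bar\ell_t(x^* )\Big)\Big\},$$ and the regret of $\mathcal A_i$ on the induced linear losses is $$\mathcal R_T(\mathcal A_i)=\sup_{(\ell_1,\dots,\ell_T)\in\mathfrak L}\Big\{\frac1T\Big(\sum_{t=1}^T\langle g^i_t,x^i_{t-h:t}\rangle-\inf_{x\in\mathcal K_i}\sum_{t=1}^T\langle g^i_t,(x,\dots,x)\rangle\Big)\Big\}.$$ These quantities take values in $(-\infty,+\infty]$. *)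

(* Defs.v *)
From HB Require Import structures.
From mathcomp Require Export all_boot all_order all_algebra.
From mathcomp Require Export all_classical all_reals.
From mathcomp Require Export ereal convex.

Set Implicit Arguments.
Unset Strict Implicit.
Unset Printing Implicit Defensive.

Import Order.TTheory GRing.Theory Num.Theory.

Local Open Scope classical_set_scope.
Local Open Scope ring_scope.

(* Finite families of vectors of R^d, i.e. the Euclidean space (R^d)^I, and
   real functions on a product \prod_(p : I) D p of subsets of R^d.  A point of
   this product has type [forall p, D p], each [D p] being coerced to a type. *)
Section ProductDomain.
Context {R : realType} {d : nat} {I : finType}.

Definition dot (u v : I -> 'rV[R]_d) : R :=
  \sum_(p : I) \sum_(j < d) u p 0 j * v p 0 j.

Definition enorm (u : I -> 'rV[R]_d) : R := Num.sqrt (dot u u).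

Context {D : I -> set 'rV[R]_d}.
Implicit Types (f : (forall p, D p) -> R) (x y z : forall p, D p).

Definition vecs x : I -> 'rV[R]_d := fun p => \val (x p).

Definition vsub y x : I -> 'rV[R]_d := fun p => \val (y p) - \val (x p).

(* Convexity of a function on the product.  The point z = a x + (1 - a) y is
   quantified over because it has to come with its membership proofs; it always
   exists when the sets D p are convex. *)
Definition convex_on f : Prop :=
  forall x y z (a : R), 0 <= a <= 1 ->
    (forall p, \val (z p) = a *: \val (x p) + (1 - a) *: \val (y p)) ->
    f z <= a * f x + (1 - a) * f y.

(* [g] is a gradient of f at x:
     f y = f x + <g, y - x> + o(|y - x|)   as y -> x inside the domain.
   It is unique when every D p spans R^d affinely (e.g. has an interior point);
   in general it is determined up to vectors orthogonal to the domain. *)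
Definition is_gradient f x (g : I -> 'rV[R]_d) : Prop :=
  forall e : R, 0 < e -> exists2 delta : R, 0 < delta &
    forall y, enorm (vsub y x) < delta ->
      `|f y - f x - dot g (vsub y x)| <= e * enorm (vsub y x).

Definition differentiable_at f x : Prop := exists g, is_gradient f x g.

Definition differentiable_on f : Prop := forall x, differentiable_at f x.

End ProductDomain.

Section MultiplayerOCOM.
Context {R : realType} {k d : nat} (K : 'I_k -> set 'rV[R]_d) (h : nat).

(* K = K_1 x ... x K_k. *)
Definition joint : Type := forall i : 'I_k, K i.

(* K^(h+1): the component (s, i) is the decision of player i at position s of
   the window, position 0 being the oldest round. *)
Definition jwindow : Type := forall p : 'I_h.+1 * 'I_k, K p.2.

(* K_i^(h+1). *)
Definition pwindow (i : 'I_k) : Type := forall s : 'I_h.+1, K i.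

(* (R^d)^(h+1). *)
Definition vwindow : Type := 'I_h.+1 -> 'rV[R]_d.

Definition loss : Type := jwindow -> R.

(* The argument is the list of the losses fed in the previous rounds, oldest
   first; the current round is the size of this list plus one. *)
Definition ocom_algorithm (i : 'I_k) : Type := seq (pwindow i -> R) -> K i.

(* A version of the gradient of the functions on K_i^(h+1) differentiable at
   the given point. *)
Definition gradient_version (i : 'I_k)
    (nabla : (pwindow i -> R) -> pwindow i -> vwindow) : Prop :=
  forall (f : pwindow i -> R) (z : pwindow i),
    differentiable_at f z -> is_gradient f z (nabla f z).

(* bar l (x) = l (x, ..., x). *)
Definition loss_diag (l : loss) (x : joint) : R := l (fun p => x p.2).

(* l^i (z) = l (z, w^{-i}). *)
Definition player_loss (l : loss) (w : jwindow) (i : 'I_k) (z : pwindow i) : R :=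
  l (fun p => dfwith (fun j : 'I_k => w (p.1, j)) i (z p.1) p.2).

Definition linear_loss (i : 'I_k) (g : vwindow) (z : pwindow i) : R :=
  dot g (vecs z).

(* Rounds are integers; x_(t-h:t). *)
Definition window (x : int -> joint) (t : int) : jwindow :=
  fun p => x (t - h%:Z + (p.1 : nat)%:Z) p.2.

Definition player_window (w : jwindow) (i : 'I_k) : pwindow i :=
  fun s => w (s, i).

Section Procedure.
Variables (A : forall i, ocom_algorithm i)
  (nabla : forall i, (pwindow i -> R) -> pwindow i -> vwindow)
  (x0 : int -> joint).

(* For each player i, the list g^i_1, g^i_2, ... computed so far. *)
Definition history : Type := 'I_k -> seq vwindow.

(* x_t: the fixed point [x0 t] if t <= 0, and otherwise the predictions of the
   algorithms, A_i having been fed <g^i_1, .>, ..., <g^i_(t-1), .>. *)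
Definition decision (G : history) (t : int) : joint := fun i =>
  match t with
  | Posz n.+1 => @A i [seq linear_loss (i := i) g | g <- take n (G i)]
  | _ => x0 t i
  end.

(* g^i_t = nabla l^i_t (x^i_(t-h:t)), for the decisions x and the loss l. *)
Definition round_gradient (x : int -> joint) (t : int) (l : loss) (i : 'I_k)
    : vwindow :=
  let w := window x t in @nabla i (player_loss l w (i := i)) (player_window w i).

Definition play_round (G : history) (l : loss) : history := fun i =>
  rcons (G i) (round_gradient (decision G) (size (G i)).+1%:Z l i).

Definition play (ls : seq loss) : history :=
  foldl play_round (fun _ => [::]) ls.

Variable T : nat.
Implicit Type L : T.-tuple loss.

(* The decisions x_t, t <= T, and (for the (t+1)-st loss of the tuple) the
   gradients g^i_(t+1) of the run on L. *)
Definition run_decision L : int -> joint := decision (play L).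

Definition run_window L (t : 'I_T) : jwindow :=
  window (run_decision L) t.+1%:Z.

Definition run_gradient L (t : 'I_T) (i : 'I_k) : vwindow :=
  round_gradient (run_decision L) t.+1%:Z (tnth L t) i.

Local Open Scope ereal_scope.

Definition multi_regret (admissible : set (T.-tuple loss)) : \bar R :=
  ereal_sup [set (T%:R^-1)%:E *
      ((\sum_(t < T) tnth L t (run_window L t))%R%:E -
       ereal_inf [set (\sum_(t < T) loss_diag (tnth L t) x)%R%:E
                 | x in [set: joint]])
    | L in admissible].

Definition player_regret (admissible : set (T.-tuple loss)) (i : 'I_k)
    : \bar R :=
  ereal_sup [set (T%:R^-1)%:E *
      ((\sum_(t < T) linear_loss (run_gradient L t i)
          (player_window (run_window L t) i))%R%:E -
       ereal_inf [set (\sum_(t < T) linear_loss (i := i) (run_gradient L t i)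
                         (fun _ => x))%R%:E
                 | x in [set: K i]])
    | L in admissible].

End Procedure.
End MultiplayerOCOM.

(* Main.v *)
(** By convexity the excess loss l_t(x_{t-h:t}) - l_t(x, ..., x) is at most
    <grad l_t(x_{t-h:t}), x_{t-h:t} - (x, ..., x)>.  This inner product splits
    over the players, and player i's block of the gradient is a gradient of
    l^i_t.  The K_i may have empty interior, so the version of the gradient of
    l^i_t used by the procedure may be another one; both agree, however, on
    differences of points of the convex set K_i^(h+1).  Summing over t bounds
    the multi-agent regret against x by the sum of the linear regrets against
    the components of x. *)
Require Import Defs.
From mathcomp Require Import lra.

Set Implicit Arguments.
Unset Strict Implicit.
Unset Printing Implicit Defensive.

Import Order.TTheory GRing.Theory Num.Theory.

Local Open Scope classical_set_scope.
Local Open Scope ring_scope.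

Section Dot.
Context {R : realType} {d : nat} {I : finType}.
Implicit Types u v w : I -> 'rV[R]_d.

Lemma dot_scaler (a : R) u v w :
  (forall p, w p = a *: v p) -> dot u w = a * dot u v.
Proof.
move=> wE; rewrite /dot mulr_sumr; apply: eq_bigr => p _.
rewrite mulr_sumr; apply: eq_bigr => j _.
by rewrite wE mxE mulrCA.
Qed.

Lemma dot_subr u v w : dot u (fun p => v p - w p) = dot u v - dot u w.
Proof.
rewrite /dot -sumrB; apply: eq_bigr => p _.
by rewrite -sumrB; apply: eq_bigr => j _; rewrite !mxE mulrBr.
Qed.

Lemma enorm_ge0 u : 0 <= enorm u.
Proof. exact: sqrtr_ge0. Qed.

Lemma enorm_scale (a : R) u v :
  0 <= a -> (forall p, v p = a *: u p) -> enorm v = a * enorm u.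
Proof.
move=> a0 vE; rewrite /enorm (dot_scaler _ vE).
have -> : dot v u = a * dot u u.
  rewrite /dot mulr_sumr; apply: eq_bigr => p _.
  rewrite mulr_sumr; apply: eq_bigr => j _.
  by rewrite vE mxE mulrA.
by rewrite mulrA -expr2 sqrtrM ?sqr_ge0// sqrtr_sqr ger0_norm.
Qed.

End Dot.

(** Packs the real [a] into the interval type over which [convex_set] quantifies. *)
Lemma convex_set_segment (R : realType) (d : nat) (D : set 'rV[R]_d)
    (x y : D) (a : R) :
  convex_set D -> 0 <= a <= 1 ->
  exists z : D, \val z = a *: \val x + (1 - a) *: \val y.
Proof.
move=> cD a01.
have a01' : Itv.spec (@Itv.num_sem R) (Itv.Real `[0%Z, 1%Z]) a.
  by rewrite /= /Itv.num_sem/= num_real/= in_itv/=.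
have := cD _ _ (Itv.mk a01') (valP x) (valP y).
by move=> zD; exists (SigSub zD).
Qed.

Section Gradient.
Context {R : realType} {d : nat} {I : finType} {D : I -> set 'rV[R]_d}.
Implicit Types (f : (forall p, D p) -> R) (x y z : forall p, D p).
Implicit Types g : I -> 'rV[R]_d.

Definition segment_point (a : R) x y z :=
  forall p, \val (z p) = a *: \val (x p) + (1 - a) *: \val (y p).

Lemma segment_pointP (a : R) x y :
  (forall p, convex_set (D p)) -> 0 <= a <= 1 -> exists z, segment_point a x y z.
Proof.
move=> cD a01.
have zP p := cid (convex_set_segment (x p) (y p) (cD p) a01).
by exists (fun p => sval (zP p)) => p; exact: svalP (zP p).
Qed.

Lemma segment_point_vsub (a : R) x y z :
  segment_point a y x z -> forall p, vsub z x p = a *: vsub y x p.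
Proof.
by move=> zE p; rewrite /vsub zE scalerBr scalerBl scale1r addrA addrAC addrK addrC.
Qed.

(** Along the segment from [x] to [y] one has |z - x| = a |y - x|, so the remainder o(|z - x|) is
    o(a). The bound covers all small [a], so two gradients can be compared at a common [a]. *)
Lemma gradient_segment f x g y (e : R) : is_gradient f x g -> 0 < e ->
  exists2 b : R, 0 < b <= 1 & forall (a : R) z, 0 < a <= b ->
    segment_point a y x z -> `|f z - f x - a * dot g (vsub y x)| <= a * e.
Proof.
move=> gP e0; set N := enorm (vsub y x).
have N0 : 0 <= N := enorm_ge0 _.
(* Dividing by [N + 1] rather than [N] covers the case where [y] is [x]; the error becomes a N e /
   (N + 1) <= a e. *)
have N1 : 0 < N + 1 by rewrite ltr_wpDl.
have [delta delta0 deltaP] := gP _ (divr_gt0 e0 N1).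
exists (Num.min 1 (delta / (N + 1))).
  by rewrite lt_min ltr01 divr_gt0//= ge_min lexx.
move=> a z /andP[a0]; rewrite le_min => /andP[a1 adelta] zE.
have zx := segment_point_vsub zE.
have nE : enorm (vsub z x) = a * N by rewrite (enorm_scale (ltW a0) zx).
rewrite ler_pdivlMr// in adelta.
have := deltaP z; rewrite nE (dot_scaler _ zx) => /(_ _)/le_trans; apply.
  by apply: lt_le_trans adelta; rewrite ltr_pM2l// ltrDl.
rewrite mulrCA ler_pM2l// -mulrA ler_piMr ?(ltW e0)//.
by rewrite mulrC ler_pdivrMr// mul1r lerDl.
Qed.

(** Both sides are the directional derivative of [f] at [x] towards [y]; convexity of the [D p]
    keeps the segment inside the domain. *)
Lemma gradient_unique f x g g' y : (forall p, convex_set (D p)) ->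
  is_gradient f x g -> is_gradient f x g' ->
  dot g (vsub y x) = dot g' (vsub y x).
Proof.
move=> cD; suff le h h' : is_gradient f x h -> is_gradient f x h' ->
    dot h (vsub y x) <= dot h' (vsub y x).
  by move=> gP g'P; apply/eqP; rewrite eq_le !le.
move=> hP h'P; apply/ler_addgt0Pr => e e0.
(* The two expansions, each with error a e / 2, are compared at the same point [z] of the
   segment. *)
have e2 : 0 < e / 2 by rewrite divr_gt0.
have [b /andP[b0 b1] bP] := gradient_segment y hP e2.
have [b' /andP[b'0 b'1] b'P] := gradient_segment y h'P e2.
pose a := Num.min b b'.
have a0 : 0 < a by rewrite lt_min b0.
have ab : a <= b by rewrite ge_min lexx.
have ab' : a <= b' by rewrite ge_min lexx orbT.
have [|z zE] := @segment_pointP a y x cD.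
  by rewrite (ltW a0) (le_trans ab).
have := bP a z; rewrite a0 ab => /(_ isT zE); rewrite ler_norml => /andP[h1 _].
have := b'P a z; rewrite a0 ab' => /(_ isT zE); rewrite ler_norml => /andP[_ h2].
rewrite -(ler_pM2l a0); lra.
Qed.

(** On the segment, convexity gives f z - f x <= a (f y - f x), while f z - f x equals a <g, y - x>
    up to a e; divide by [a], with [e] arbitrary. *)
Lemma convex_gradient f x g y : (forall p, convex_set (D p)) ->
  convex_on f -> is_gradient f x g -> f x + dot g (vsub y x) <= f y.
Proof.
move=> cD cf gP; apply/ler_addgt0Pr => e e0.
have [a /andP[a0 a1] aP] := gradient_segment y gP e0.
have a01 : 0 <= a <= 1 by rewrite ltW.
have [z zE] := segment_pointP y x cD a01.
have := aP a z; rewrite a0 lexx => /(_ isT zE); rewrite ler_norml => /andP[h1 _].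
have := cf _ _ _ _ a01 zE => h2.
rewrite -(ler_pM2l a0); lra.
Qed.

End Gradient.

Section RoundInequality.
Context {R : realType} {k d : nat} {K : 'I_k -> set 'rV[R]_d} {h : nat}.
Implicit Types (l : loss K h) (w : jwindow K h).

Lemma dot_window (u v : 'I_h.+1 * 'I_k -> 'rV[R]_d) :
  dot u v = \sum_(i < k) dot (fun s => u (s, i)) (fun s => v (s, i)).
Proof.
by rewrite /dot [RHS]exchange_big pair_bigA; apply: eq_bigr => -[].
Qed.

(** Varying only the components of player [i] embeds K_i^(h+1) isometrically in K^(h+1) and sends
    that player's part of [w] to [w], so the remainder bound of [l] at [w] restricts with the same
    [delta]. *)
Lemma player_loss_gradient l w (G : 'I_h.+1 * 'I_k -> 'rV[R]_d) i :
  is_gradient l w G ->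
  is_gradient (player_loss l w (i := i)) (player_window w i)
    (fun s => G (s, i)).
Proof.
move=> GP e e0; have [delta delta0 deltaP] := GP e e0.
exists delta => // z.
pose E (z : pwindow K h i) : jwindow K h :=
  fun p => dfwith (fun j : 'I_k => w (p.1, j)) i (z p.1) p.2.
have Ew : E (player_window w i) = w.
  apply: functional_extensionality_dep => -[s j]; rewrite /E /player_window/=.
  by case: dfwithP.
have EE s j : vsub (E z) w (s, j) =
    if j == i then vsub z (player_window w i) s else 0.
  rewrite /vsub /E/=; case: eqVneq => [->|ji]; first by rewrite dfwithin.
  by rewrite dfwithout 1?eq_sym// subrr.
have dotE (u : 'I_h.+1 * 'I_k -> 'rV[R]_d) : dot u (vsub (E z) w) =
    dot (fun s => u (s, i)) (vsub z (player_window w i)).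
  rewrite dot_window (bigD1 i)//= big1 ?addr0 => [|j ji].
    by congr dot; apply/funext => s; rewrite EE eqxx.
  rewrite /dot big1// => s _; rewrite big1// => c _.
  by rewrite EE (negbTE ji) mxE mulr0.
have nE : enorm (vsub (E z) w) = enorm (vsub z (player_window w i)).
  rewrite /enorm dotE; congr (Num.sqrt (dot _ _)).
  by apply/funext => s; rewrite EE eqxx.
have := deltaP (E z); rewrite nE dotE.
by rewrite -[X in `|_ - l X - _|]Ew.
Qed.

Lemma round_regret_le l w
    (nabla : forall i, (pwindow K h i -> R) -> pwindow K h i -> @vwindow R d h)
    (x : joint K) :
  (forall i, convex_set (K i)) -> (forall i, gradient_version (nabla i)) ->
  convex_on l -> differentiable_at l w ->
  l w - loss_diag l x <=
  \sum_(i < k)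
    (let g := nabla i (player_loss l w (i := i)) (player_window w i) in
     linear_loss g (player_window w i) - linear_loss (i := i) g (fun _ => x i)).
Proof.
move=> cK nP cl [G GP]; pose X : jwindow K h := fun p => x p.2.
have := convex_gradient X (fun p => cK p.2) cl GP.
rewrite dot_window.
rewrite (_ : \sum_(i < k) _ = - \sum_(i < k)
    (let g := nabla i (player_loss l w (i := i)) (player_window w i) in
     linear_loss g (player_window w i) - linear_loss (i := i) g (fun _ => x i))).
  by rewrite /loss_diag /= lerBlDr lerBlDl.
rewrite -sumrN; apply: eq_bigr => i _ /=.
have Gi := player_loss_gradient i GP.
(* [Gi] supplies the differentiability under which [nabla i] returns a gradient, possibly a
   different one. *)
have gi := nP i _ _ (ex_intro _ _ Gi).
rewrite opprB /linear_loss -dot_subr.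
exact: (gradient_unique (fun _ => x i) (fun _ => cK i) Gi gi).
Qed.

End RoundInequality.

(** Reduces regret against the infimum to regret against each comparator. For finite [M], s - M is a
    lower bound of [f], so the infimum cannot be -oo. *)
Lemma ge_sub_ereal_inf (R : realType) (X : Type) (s : R) (f : X -> R)
    (M : \bar R) (x0 : X) :
  (forall x, (s - f x)%:E <= M)%E ->
  (s%:E - ereal_inf [set (f x)%:E | x in [set: X]] <= M)%E.
Proof.
case: M => [M||] H; last 2 first.
- by rewrite leey.
- by have := H x0.
have : ((s - M)%:E <= ereal_inf [set (f x)%:E | x in [set: X]])%E.
  apply: le_ereal_inf_tmp => _ [x _ <-].
  by have := H x; rewrite !lee_fin lerBlDr lerBlDl addrC.
case: ereal_inf => [r||] //= H'; last by rewrite addeNy leNye.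
by move: H'; rewrite -EFinB !lee_fin lerBlDr lerBlDl addrC.
Qed.

Theorem theorem3p2 (R : realType) (k d T h : nat)
    (k_gt0 : (0 < k)%N) (d_gt0 : (0 < d)%N) (T_gt0 : (0 < T)%N)
    (K : 'I_k -> set 'rV[R]_d)
    (K_nonempty : forall i, K i !=set0)
    (K_convex : forall i, convex_set (K i))
    (A : forall i, ocom_algorithm K h i)
    (nabla : forall i, (pwindow K h i -> R) -> pwindow K h i ->
                       @vwindow R d h)
    (nablaP : forall i, gradient_version (nabla i))
    (x0 : int -> joint K)
    (admissible : set (T.-tuple (loss K h)))
    (admissible_nonempty : admissible !=set0)
    (admissible_convex : forall L, admissible L ->
       forall t : 'I_T, convex_on (tnth L t))
    (admissible_differentiable : forall L, admissible L ->
       forall t : 'I_T, differentiable_on (tnth L t)) :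
  (multi_regret A nabla x0 admissible <=
     \sum_(i < k) player_regret A nabla x0 admissible i)%E.
Proof.
apply: ge_ereal_sup => _ [L LP <-].
set xs := x0 0.
pose S i := \sum_(t < T) linear_loss (run_gradient A nabla x0 L t i)
          (player_window (run_window A nabla x0 L t) i).
pose B i (x : K i) := \sum_(t < T) linear_loss (i := i)
          (run_gradient A nabla x0 L t i) (fun _ => x).
pose X i := ((S i)%:E - ereal_inf [set (B i x)%:E | x in [set: K i]])%E.
have XB i x : ((S i - B i x)%:E <= X i)%E.
  rewrite EFinB; apply: leeB => //.
  by apply: ereal_inf_lbound; exists x.
(* For this fixed [L], each scaled [X i] is one of the values whose supremum is the regret of player
   [i]. *)
apply: (@le_trans _ _ (\sum_(i < k) ((T%:R^-1)%:E * X i))%E); last first.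
  by apply: lee_sum => i _; apply: ereal_sup_ubound; exists L.
(* [X i] may be +oo but, by comparison with the point [xs i], not -oo; hence 1/T distributes over
   the sum. *)
have XNy i : X i != -oo%E.
  by have := XB i (xs i); case: (X i).
rewrite -fin_num_sume_distrr//; last first.
  by move=> i j _ _; move: (XNy i) (XNy j); case: (X i) => [?||]; case: (X j).
rewrite lee_pmul2l// ?lte_fin ?invr_gt0 ?ltr0n//.
(* One joint comparator [x] is fixed; its components serve as comparators for all players at
   once. *)
apply: (ge_sub_ereal_inf xs) => x.
apply: (@le_trans _ _ (\sum_(i < k) (S i - B i (x i))%:E)%E); last first.
  exact: lee_sum.
rewrite sumEFin lee_fin -sumrB.
under [leRHS]eq_bigr do rewrite /S /B -sumrB.
rewrite exchange_big; apply: ler_sum => t _.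
apply: round_regret_le => //; first exact: admissible_convex.
exact: admissible_differentiable.
Qed.
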